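(* Let $s\ge 1$, let $L\in\mathbb{R}^{s\times s}$ be strictly lower triangular, and let $W_c=I+L+L^\top$. Let $\widetilde m\in\mathbb{R}^s$, let $\widetilde{\alpha}^{(0)}=0$, and let $\widetilde{\alpha}^{(\nu)}$ ($\nu\ge 1$) be obtained after $\nu$ forward Gauss--Seidel sweeps applied to $W_c\widetilde{\alpha}=\widetilde m$. Then for every $\nu\ge1$ the residual satisfies $$\widetilde{\rho}^{(\nu)}:=\widetilde m-W_c\widetilde{\alpha}^{(\nu)}=(-1)^\nu\left(L^\top(I+L)^{-1}\right)^\nu\widetilde m .$$ Consequently, $$\left\|\widetilde{\rho}^{(\nu)}\right\|\le\left\|L^\top(I+L)^{-1}\right\|^\nu\left\|\widetilde m\right\| ,$$ where $\|\cdot\|$ denotes a vector norm on $\mathbb{R}^s$ and its induced (sub-multiplicative) matrix norm.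
   Context: $I$ denotes the $s\times s$ identity matrix. The forward Gauss--Seidel iteration for $W_c\widetilde\alpha=\widetilde m$ with $W_c=I+L+L^\top$ computes $\widetilde\alpha^{(\nu+1)}$ from $\widetilde\alpha^{(\nu)}$ by $$(I+L)\widetilde{\alpha}^{(\nu+1)}=\widetilde m-L^\top\widetilde{\alpha}^{(\nu)},\qquad \nu\ge 0;$$ one such step is one sweep. *)

(* Defs.v *)
From mathcomp Require Import all_boot all_order all_algebra.
From mathcomp Require Import classical_sets reals.

Set Implicit Arguments.
Unset Strict Implicit.
Unset Printing Implicit Defensive.

Import Order.TTheory GRing.Theory Num.Theory.
Local Open Scope classical_set_scope.
Local Open Scope ring_scope.

(* The library's [is_trig_mx] allows a nonzero diagonal. *)
Definition strictly_lower_triangular (R : realType) (s : nat) (L : 'M[R]_s) :=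
  forall i j : 'I_s, (i <= j)%N -> L i j = 0.

Definition Wc (R : realType) (s : nat) (L : 'M[R]_s) : 'M[R]_s :=
  1%:M + L + L^T.

(* The sweep is left implicit, as a linear system for the new iterate; when [L]
   is strictly lower triangular, [1%:M + L] is invertible and the sequence is
   determined by its first term. *)
Definition forward_gauss_seidel (R : realType) (s : nat) (L : 'M[R]_s)
    (m : 'cV[R]_s) (alpha : nat -> 'cV[R]_s) :=
  forall nu : nat, (1%:M + L) *m alpha nu.+1 = m - L^T *m alpha nu.

(* A predicate on functions rather than an instance of a normed-module
   structure: 'cV[R]_s canonically carries the max norm, whereas here the norm
   is arbitrary. Nonnegativity follows from the three axioms. *)
Record vector_norm (R : realType) (s : nat) (N : 'cV[R]_s -> R) : Prop :=
  VectorNorm {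
    vector_norm_eq0 : forall x, N x = 0 -> x = 0;
    vector_normZ : forall (a : R) x, N (a *: x) = `|a| * N x;
    vector_normD : forall x y, N (x + y) <= N x + N y }.

(* For [N] a norm and 0 < s, the set is nonempty and bounded, so [sup] is a
   genuine supremum. *)
Definition induced_norm (R : realType) (s : nat) (N : 'cV[R]_s -> R)
    (A : 'M[R]_s) : R :=
  sup [set N (A *m x) | x in [set x | N x = 1]].

(* Main.v *)
Require Import Defs.
From mathcomp Require Import all_boot all_order all_algebra.
From mathcomp Require Import reals.
From mathcomp Require Import boolp classical_sets topology normedtype derive.

(** One sweep multiplies the residual by [- G] with [G = L^T (I + L)^-1].
    Indeed the sweep equation at [nu] gives, with [rho nu] the residual,
    [rho nu = (I + L) (alpha nu.+1 - alpha nu)] and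
    [rho nu.+1 = - L^T (alpha nu.+1 - alpha nu)], and [I + L] is invertible
    because it is triangular with unit diagonal ([residual_step]). Since
    [alpha 0 = 0], the initial residual is [m] and the formula follows by
    induction.

    The norm estimate needs [N (A x) <= induced_norm N A * N x]
    ([le_induced_norm]). The induced norm is a supremum of real numbers, which
    bounds its set only if that set is bounded, so the inequality rests on the
    continuity of linear maps for an arbitrary norm in finite dimension. That is
    the comparison of [N] with the max norm: the triangle inequality bounds
    [N (A x)] by a multiple of the max norm of [x] ([vector_norm_mulmx_le]), so
    [N] is continuous, and its minimum over the compact unit sphere of the max
    norm bounds the max norm by a multiple of [N] ([vector_norm_ge]). *)

Import Order.TTheory GRing.Theory Num.Theory.
Import numFieldNormedType.Exports.
Local Open Scope ring_scope.

(** * Propagation of the residual *)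

Lemma unitriangular_unitmx (R : realType) (s : nat) (L : 'M[R]_s) :
  strictly_lower_triangular L -> 1%:M + L \in unitmx.
Proof.
move=> hL; rewrite unitmxE det_trig.
  rewrite big1 ?unitr1// => i _.
  by rewrite !mxE eqxx hL ?addr0.
apply/is_trig_mxP => i j ij.
by rewrite !mxE hL 1?ltnW// -val_eqE (ltn_eqF ij) addr0.
Qed.

Lemma residual_step {R : realType} {s : nat} {L : 'M[R]_s} {m : 'cV[R]_s}
    {alpha : nat -> 'cV[R]_s} (nu : nat) :
  strictly_lower_triangular L -> forward_gauss_seidel L m alpha ->
  m - Wc L *m alpha nu.+1 =
    - (L^T *m invmx (1%:M + L) *m (m - Wc L *m alpha nu)).
Proof.
move=> hL sweep.
have m_eq : m = (1%:M + L) *m alpha nu.+1 + L^T *m alpha nu.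
  by rewrite sweep subrK.
have old_residual :
    m - Wc L *m alpha nu = (1%:M + L) *m (alpha nu.+1 - alpha nu).
  rewrite {1}m_eq /Wc [(1%:M + L + _) *m _]mulmxDl mulmxBr.
  by rewrite opprD addrACA subrr addr0.
have new_residual :
    m - Wc L *m alpha nu.+1 = - (L^T *m (alpha nu.+1 - alpha nu)).
  rewrite {1}m_eq /Wc [(1%:M + L + _) *m _]mulmxDl mulmxBr.
  by rewrite opprB opprD addrACA subrr add0r.
rewrite new_residual old_residual -mulmxA mulKmx//.
exact: unitriangular_unitmx.
Qed.

(** * Norms on column vectors *)

Section VectorNorm.
Context {R : realType} {s : nat} {N : 'cV[R]_s -> R} (normN : vector_norm N).

Lemma vector_norm0 : N 0 = 0.
Proof. by rewrite -(scale0r 0) (vector_normZ normN) normr0 mul0r. Qed.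

Lemma vector_normN x : N (- x) = N x.
Proof. by rewrite -scaleN1r (vector_normZ normN) normrN1 mul1r. Qed.

Lemma vector_norm_ge0 x : 0 <= N x.
Proof.
have := vector_normD normN x (- x).
by rewrite subrr vector_norm0 vector_normN -mulr2n pmulrn_lge0.
Qed.

Lemma vector_norm_sum {I : Type} (r : seq I) (F : I -> 'cV[R]_s) :
  N (\sum_(i <- r) F i) <= \sum_(i <- r) N (F i).
Proof.
elim/big_ind2 : _ => [|x a y b xa yb|//]; first by rewrite vector_norm0.
exact: le_trans (vector_normD normN _ _) (lerD xa yb).
Qed.

(** With [A = 1%:M] this gives the continuity of [N], with a general [A] the
    boundedness of [A] on the unit sphere of [N]. The vector is the column of a
    row [v] because the Heine-Borel theorem, used below, concerns rows. *)
Lemma vector_norm_mulmx_le (A : 'M[R]_s) (v : 'rV[R]_s) :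
  N (A *m v^T) <= (\sum_j N (col j A)) * `|v|.
Proof.
have -> : A *m v^T = \sum_j v 0 j *: col j A.
  apply/colP => i; rewrite mxE summxE; apply: eq_bigr => j _.
  by rewrite !mxE mulrC.
apply: le_trans (vector_norm_sum _ _) _.
rewrite mulr_suml; apply: ler_sum => j _.
rewrite (vector_normZ normN) mulrC ler_wpM2l ?vector_norm_ge0//.
rewrite [leRHS]/Num.norm/= mx_normrE.
by apply: (le_bigmax _ (fun ij => `|v ij.1 ij.2|) (0, j)).
Qed.

Lemma vector_norm_dist x y : `|N x - N y| <= N (x - y).
Proof.
have half u v : N u - N v <= N (u - v).
  by rewrite lerBlDr -{1}(subrK v u) (vector_normD normN).
by rewrite ler_norml half lerNl opprB -(vector_normN (x - y)) opprB half.
Qed.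

Lemma vector_norm_continuous : continuous (fun v : 'rV[R]_s => N v^T).
Proof.
move=> v; set C := \sum_j N (col j (1%:M : 'M[R]_s)).
have C0 : 0 <= C by apply: sumr_ge0 => j _; exact: vector_norm_ge0.
apply/(@cvgrPdist_lt _ _ _ (nbhs v)) => e e0.
(* [1 + C] rather than [C], which vanishes in dimension 0. *)
have C1 : 0 < 1 + C by rewrite ltr_wpDr.
near=> w.
apply: (le_lt_trans (vector_norm_dist _ _)).
rewrite -linearB -[X in N X]mul1mx.
apply: (le_lt_trans (vector_norm_mulmx_le _ _)).
have vw : `|v - w| < e / (1 + C).
  by near: w; apply: cvgr_dist_lt; [exact: cvg_id | exact: divr_gt0].
apply: (@le_lt_trans _ _ ((1 + C) * `|v - w|)).
  by rewrite ler_wpM2r// lerDr.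
by rewrite mulrC -ltr_pdivlMr.
Unshelve. all: by end_near. Qed.

(** The constant is the minimum of [N] over the unit sphere of the max norm; it
    is positive because [N] vanishes only at 0. *)
Lemma vector_norm_ge : exists2 c : R, 0 < c & forall v : 'rV[R]_s,
  c * `|v| <= N v^T.
Proof.
have [[u u0]|trivial] := pselect (exists u : 'rV[R]_s, u != 0); last first.
  exists 1 => // v; have [->|v0] := eqVneq v 0.
    by rewrite normr0 mulr0 vector_norm_ge0.
  by case: trivial; exists v.
pose S := [set v : 'rV[R]_s | `|v| = 1]%classic.
have normalize (v : 'rV[R]_s) : v != 0 -> S (`|v|^-1 *: v).
  by move=> v0; rewrite /S /= normrZ normfV normr_id mulVf// normr_eq0.
have S0 : (S !=set0)%classic by exists (`|u|^-1 *: u); exact: normalize.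
have compactS : compact S.
  apply: bounded_closed_compact.
    by exists 1; split=> // M M1 v /= ->; exact: ltW.
  apply: (@closed_comp _ _ (fun v : 'rV[R]_s => `|v|) [set x | x = 1]%classic).
    by move=> v _; exact: norm_continuous.
  exact: closed_eq.
have [w] := EVT_min_rV S0 compactS
  (continuous_subspaceT vector_norm_continuous).
rewrite inE => Sw minw; exists (N w^T).
  rewrite lt_neqAle vector_norm_ge0 andbT eq_sym; apply/eqP.
  move=> /(vector_norm_eq0 normN) wT0.
  have w0 : w = 0 by rewrite -[w]trmxK wT0 trmx0.
  by move: Sw; rewrite /S /= w0 normr0 => /esym/eqP; rewrite oner_eq0.
move=> v; have [->|v0] := eqVneq v 0.
  by rewrite normr0 mulr0 vector_norm_ge0.
have := minw (`|v|^-1 *: v); rewrite inE => /(_ (normalize _ v0)).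
rewrite linearZ/= (vector_normZ normN) normfV normr_id mulrC.
by rewrite ler_pdivlMr// normr_gt0.
Qed.

Lemma vector_norm_mulmx_bounded (A : 'M[R]_s) :
  has_ubound [set N (A *m x) | x in [set x | N x = 1]]%classic.
Proof.
have [c c0 cN] := vector_norm_ge.
set C := \sum_j N (col j A).
exists (C / c) => _ [x /= Nx1 <-].
rewrite -(trmxK x); apply: (le_trans (vector_norm_mulmx_le _ _)).
rewrite ler_wpM2l//; first by apply: sumr_ge0 => j _; exact: vector_norm_ge0.
by rewrite -[leRHS]mul1r ler_pdivlMr// mulrC -Nx1 -[in leRHS](trmxK x) cN.
Qed.

Lemma le_induced_norm (A : 'M[R]_s) (x : 'cV[R]_s) :
  N (A *m x) <= induced_norm N A * N x.
Proof.
have [Nx0|Nx0] := eqVneq (N x) 0.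
  by rewrite Nx0 mulr0 (vector_norm_eq0 normN Nx0) mulmx0 vector_norm0.
have Nx_gt0 : 0 < N x by rewrite lt_neqAle eq_sym Nx0 vector_norm_ge0.
rewrite -ler_pdivrMr//.
apply: (ub_le_sup (vector_norm_mulmx_bounded A)).
have abs_inv : `|(N x)^-1| = (N x)^-1.
  by rewrite ger0_norm// invr_ge0 vector_norm_ge0.
exists ((N x)^-1 *: x); first by rewrite /= (vector_normZ normN) abs_inv mulVf.
by rewrite -scalemxAr (vector_normZ normN) abs_inv mulrC.
Qed.

Lemma induced_norm_ge0 (A : 'M[R]_s) : 0 <= induced_norm N A.
Proof.
rewrite /induced_norm; set E := (X in sup X).
(* An empty unit sphere is the case of dimension 0, where the supremum is 0. *)
have [[_ [x Nx1 _]]|/nonemptyPn ->] := pselect (E !=set0)%classic; last first.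
  by rewrite sup0.
apply: le_trans (vector_norm_ge0 (A *m x)) _.
by apply: (ub_le_sup (vector_norm_mulmx_bounded A)); exists x.
Qed.

Lemma vector_norm_expmx_le (A : 'M[R]_s) (n : nat) (x : 'cV[R]_s) :
  N (A ^+ n *m x) <= induced_norm N A ^+ n * N x.
Proof.
elim: n => [|n IHn]; first by rewrite !expr0 mul1mx mul1r.
rewrite !exprS -mulmxA -mulrA; apply: le_trans (le_induced_norm _ _) _.
by rewrite ler_wpM2l// induced_norm_ge0.
Qed.

End VectorNorm.

(** * The residual after a number of sweeps *)

Theorem proposition1 (R : realType) (s : nat) (hs : (1 <= s)%N)
    (L : 'M[R]_s) (hL : strictly_lower_triangular L)
    (m : 'cV[R]_s) (alpha : nat -> 'cV[R]_s)
    (halpha0 : alpha 0%N = 0)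
    (halpha : forward_gauss_seidel L m alpha) :
  let rho := fun nu : nat => m - Wc L *m alpha nu in
  let G := L^T *m invmx (1%:M + L) in
  (forall nu : nat, (1 <= nu)%N -> rho nu = (-1) ^+ nu *: (G ^+ nu *m m)) /\
  (forall N : 'cV[R]_s -> R, vector_norm N ->
   forall nu : nat, (1 <= nu)%N -> N (rho nu) <= induced_norm N G ^+ nu * N m).
Proof.
move=> rho G.
have rhoE nu : rho nu = (-1) ^+ nu *: (G ^+ nu *m m).
  elim: nu => [|nu IHnu].
    by rewrite /rho halpha0 mulmx0 subr0 !expr0 mul1mx scale1r.
  rewrite /rho (residual_step nu hL halpha) -/(rho nu) -/G IHnu.
  by rewrite -scalemxAr mulmxA !exprS mulN1r scaleNr.
split=> [nu _|N normN nu _]; first exact: rhoE.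
rewrite rhoE (vector_normZ normN) normrX normrN1 expr1n mul1r.
exact: vector_norm_expmx_le.
Qed.
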